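(* Let $(\mathscr{D},\bullet,\circ,1)$ be a normal duoidal category. Then every double opmonoidal monad on $\mathscr{D}$ is a linearly distributive bimonad on $\mathscr{D}$ (with $\mathscr{D}$ regarded as a linearly distributive category with $\otimes=\circ$ and $\odot=\bullet$).
   Context: Composition of morphisms is written $\cdot$ or by juxtaposition. Duoidal category: a category $\mathscr{D}$ with monoidal structures $(\circ,\bot)$, $(\bullet,1)$, a natural (not necessarily invertible) interchange law $\zeta\colon(x\bullet y)\circ(a\bullet b)\to(x\circ a)\bullet(y\circ b)$, and morphisms $\nu\colon\bot\to\bot\bullet\bot$, $\varpi\colon1\circ1\to1$, $\iota\colon\bot\to1$ such that $(1,\varpi,\iota)$ is a monoid in $(\mathscr{D},\circ,\bot)$, $(\bot,\nu,\iota)$ is a comonoid in $(\mathscr{D},\bullet,1)$, and $\zeta$ is associative for triple $\circ$- and triple $\bullet$-products and unital with respect to $\nu$ and $\varpi$. It is normal if $\bot\cong1$ (via $\iota$); one identifies the two units. A normal duoidal category is linearly distributive with linear distributors $\partial_\ell^\ell\colon a\circ(b\bullet c)\cong(a\bullet1)\circ(b\bullet c)\xrightarrow{\zeta}(a\circ b)\bullet(1\circ c)\cong(a\circ b)\bullet c$, $\partial_r^\ell\colon a\circ(b\bullet c)\cong(1\bullet a)\circ(b\bullet c)\xrightarrow{\zeta}(1\circ b)\bullet(a\circ c)\cong b\bullet(a\circ c)$, $\partial_\ell^r\colon(b\bullet c)\circ a\cong(b\bullet c)\circ(a\bullet1)\xrightarrow{\zeta}(b\circ a)\bullet(c\circ1)\cong(b\circ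 a)\bullet c$, $\partial_r^r\colon(b\bullet c)\circ a\cong(b\bullet c)\circ(1\bullet a)\xrightarrow{\zeta}(b\circ1)\bullet(c\circ a)\cong b\bullet(c\circ a)$. A double opmonoidal monad on a duoidal category is a monad $(T,\mu,\eta)$ with bimonad structures $(T_2^\circ,T_0^\circ)$ on $(\mathscr{D},\circ,\bot)$ and $(T_2^\bullet,T_0^\bullet)$ on $(\mathscr{D},\bullet,1)$ (oplax monoidal structures for which $\mu,\eta$ are oplax monoidal transformations), such that the structure morphisms are compatible with $T$: $\nu\,T_0^\circ=(T_0^\circ\bullet T_0^\circ)\,T^\bullet_{2;\bot,\bot}\,T\nu$, $\ T_0^\bullet\,T\varpi=\varpi\,(T_0^\bullet\circ T_0^\bullet)\,T^\circ_{2;1,1}$, $\ T_0^\bullet\,T\iota=\iota\,T_0^\circ$, and $\zeta\,(T^\bullet_{2;a,b}\circ T^\bullet_{2;c,d})\,T^\circ_{2;a\bullet b,c\bullet d}=(T^\circ_{2;a,c}\bullet T^\circ_{2;b,d})\,T^\bullet_{2;a\circ c,b\circ d}\,T\zeta$. A linearly distributive bimonad is a monad $T$ with bimonad structures for both $\circ$ and $\bullet$ such that for all $T$-algebras $a,b,c$ the following hold: $\partial_\ell^\ell\,(Ta\circ T^\bullet_{2;b,c})\,T^\circ_{2;a,b\bullet c}=(T^\circ_{2;a,b}\bullet Tc)\,T^\bullet_{2;a\circ b,c}\,T\partial_\ell^\ell$; $\partial_r^r\,(T^\bullet_{2;b,c}\circ Ta)\,T^\circ_{2;b\bullet c,a}=(Tb\bullet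 T^\circ_{2;c,a})\,T^\bullet_{2;b,c\circ a}\,T\partial_r^r$; $\partial_r^\ell\,(Ta\circ T^\bullet_{2;b,c})\,T^\circ_{2;a,b\bullet c}=(Tb\bullet T^\circ_{2;a,c})\,T^\bullet_{2;b,a\circ c}\,T\partial_r^\ell$; $\partial_\ell^r\,(T^\bullet_{2;b,c}\circ Ta)\,T^\circ_{2;b\bullet c,a}=(T^\circ_{2;b,a}\bullet Tc)\,T^\bullet_{2;b\circ a,c}\,T\partial_\ell^r$. *)

(* Defs.v *)
(* Only the Rocq prelude is used.  Morphisms are compared with Leibniz equality;
   no monoidal structure is assumed strict. *)

Set Implicit Arguments.
Unset Strict Implicit.

Declare Scope cat_scope.
Delimit Scope cat_scope with cat.
Local Open Scope cat_scope.

Record Category : Type := MkCategory {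
  ob :> Type;
  hom : ob -> ob -> Type;
  idm : forall a, hom a a;
  comp : forall a b c, hom b c -> hom a b -> hom a c;
  comp_idl : forall a b (f : hom a b), comp (idm b) f = f;
  comp_idr : forall a b (f : hom a b), comp f (idm a) = f;
  comp_assoc : forall a b c d (h : hom c d) (g : hom b c) (f : hom a b),
    comp h (comp g f) = comp (comp h g) f
}.
Arguments idm {_} _.
Arguments hom {_} _ _.

(* [g · f] is "first [f], then [g]". *)
Notation "g · f" := (comp g f) (at level 40, left associativity) : cat_scope.

Record IsIso (C : Category) (a b : C) (f : hom a b) : Type := MkIsIso {
  inv : hom b a;
  inv_l : inv · f = idm a;
  inv_r : f · inv = idm b
}.

Record Functor (C D : Category) : Type := MkFunctor {
  fob :> C -> D;
  fmap : forall a b : C, hom a b -> hom (fob a) (fob b);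
  fmap_id : forall a : C, fmap (idm a) = idm (fob a);
  fmap_comp : forall (a b c : C) (g : hom b c) (f : hom a b),
    fmap (g · f) = fmap g · fmap f
}.
Arguments fmap {_ _} _ {_ _} _.

Record Monad (C : Category) : Type := MkMonad {
  mfun :> Functor C C;
  mu : forall a : C, hom (mfun (mfun a)) (mfun a);
  eta : forall a : C, hom a (mfun a);
  mu_nat : forall (a b : C) (f : hom a b),
    mu b · fmap mfun (fmap mfun f) = fmap mfun f · mu a;
  eta_nat : forall (a b : C) (f : hom a b),
    eta b · f = fmap mfun f · eta a;
  mu_assoc : forall a : C, mu a · fmap mfun (mu a) = mu a · mu (mfun a);
  mu_eta_l : forall a : C, mu a · eta (mfun a) = idm (mfun a);
  mu_eta_r : forall a : C, mu a · fmap mfun (eta a) = idm (mfun a)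
}.

Record Algebra (C : Category) (T : Monad C) : Type := MkAlgebra {
  carrier :> ob C;
  action : hom (T carrier) carrier;
  action_eta : action · eta T carrier = idm carrier;
  action_mu : action · mu T carrier = action · fmap T action
}.

Reserved Notation "a ⊗ b" (at level 35, right associativity).
Reserved Notation "f ⊠ g" (at level 35, right associativity).

Record Monoidal (C : Category) : Type := MkMonoidal {
  tens : C -> C -> C
    where "a ⊗ b" := (tens a b);
  tensm : forall a a' b b' : C, hom a a' -> hom b b' -> hom (a ⊗ b) (a' ⊗ b')
    where "f ⊠ g" := (tensm f g);
  unit : C;
  tensm_id : forall a b : C, idm a ⊠ idm b = idm (a ⊗ b);
  tensm_comp : forall (a a' a'' b b' b'' : C)
      (f' : hom a' a'') (f : hom a a') (g' : hom b' b'') (g : hom b b'),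
    (f' · f) ⊠ (g' · g) = (f' ⊠ g') · (f ⊠ g);

  assoc : forall a b c : C, hom ((a ⊗ b) ⊗ c) (a ⊗ (b ⊗ c));
  assoc_iso : forall a b c, IsIso (assoc a b c);
  assoc_nat : forall (a a' b b' c c' : C)
      (f : hom a a') (g : hom b b') (h : hom c c'),
    assoc a' b' c' · ((f ⊠ g) ⊠ h) = (f ⊠ (g ⊠ h)) · assoc a b c;

  lunit : forall a : C, hom (unit ⊗ a) a;
  lunit_iso : forall a, IsIso (lunit a);
  lunit_nat : forall (a a' : C) (f : hom a a'),
    lunit a' · (idm unit ⊠ f) = f · lunit a;

  runit : forall a : C, hom (a ⊗ unit) a;
  runit_iso : forall a, IsIso (runit a);
  runit_nat : forall (a a' : C) (f : hom a a'),
    runit a' · (f ⊠ idm unit) = f · runit a;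

  triangle : forall a b : C,
    (idm a ⊠ lunit b) · assoc a unit b = runit a ⊠ idm b;
  pentagon : forall a b c d : C,
    (idm a ⊠ assoc b c d) · assoc a (b ⊗ c) d · (assoc a b c ⊠ idm d)
    = assoc a b (c ⊗ d) · assoc (a ⊗ b) c d
}.

Notation "a ⊗[ M ] b" := (tens M a b)
  (at level 35, right associativity, format "a  ⊗[ M ]  b") : cat_scope.
Notation "f ⊠[ M ] g" := (tensm M f g)
  (at level 35, right associativity, format "f  ⊠[ M ]  g") : cat_scope.

Record is_monoid (C : Category) (M : Monoidal C) (x : C)
    (m : hom (x ⊗[M] x) x) (u : hom (unit M) x) : Prop := MkIsMonoid {
  monoid_assoc :
    m · (m ⊠[M] idm x) = m · (idm x ⊠[M] m) · assoc M x x x;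
  monoid_unit_l : m · (u ⊠[M] idm x) = lunit M x;
  monoid_unit_r : m · (idm x ⊠[M] u) = runit M x
}.

Record is_comonoid (C : Category) (M : Monoidal C) (x : C)
    (d : hom x (x ⊗[M] x)) (e : hom x (unit M)) : Prop := MkIsComonoid {
  comonoid_assoc :
    assoc M x x x · (d ⊠[M] idm x) · d = (idm x ⊠[M] d) · d;
  comonoid_unit_l : lunit M x · (e ⊠[M] idm x) · d = idm x;
  comonoid_unit_r : runit M x · (idm x ⊠[M] e) · d = idm x
}.

Record Oplax (C : Category) (M : Monoidal C) (F : Functor C C) : Type := MkOplax {
  opl2 : forall a b : C, hom (F (a ⊗[M] b)) (F a ⊗[M] F b);
  opl0 : hom (F (unit M)) (unit M);
  opl2_nat : forall (a a' b b' : C) (f : hom a a') (g : hom b b'),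
    opl2 a' b' · fmap F (f ⊠[M] g) = (fmap F f ⊠[M] fmap F g) · opl2 a b;
  opl_assoc : forall a b c : C,
    assoc M (F a) (F b) (F c) · (opl2 a b ⊠[M] idm (F c)) · opl2 (a ⊗[M] b) c
    = (idm (F a) ⊠[M] opl2 b c) · opl2 a (b ⊗[M] c) · fmap F (assoc M a b c);
  opl_unit_l : forall a : C,
    lunit M (F a) · (opl0 ⊠[M] idm (F a)) · opl2 (unit M) a = fmap F (lunit M a);
  opl_unit_r : forall a : C,
    runit M (F a) · (idm (F a) ⊠[M] opl0) · opl2 a (unit M) = fmap F (runit M a)
}.

(* The four equations say that [mu : T T => T] and [eta : Id => T] are oplax
   monoidal transformations, with the composite oplax structure on [T T]. *)
Record Bimonad (C : Category) (M : Monoidal C) (T : Monad C) : Type := MkBimonad {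
  bim_oplax :> Oplax M T;
  mu_opl2 : forall a b : C,
    opl2 bim_oplax a b · mu T (a ⊗[M] b)
    = (mu T a ⊠[M] mu T b) · opl2 bim_oplax (T a) (T b)
      · fmap T (opl2 bim_oplax a b);
  mu_opl0 : opl0 bim_oplax · mu T (unit M)
    = opl0 bim_oplax · fmap T (opl0 bim_oplax);
  eta_opl2 : forall a b : C,
    opl2 bim_oplax a b · eta T (a ⊗[M] b) = eta T a ⊠[M] eta T b;
  eta_opl0 : opl0 bim_oplax · eta T (unit M) = idm (unit M)
}.

Record Duoidal : Type := MkDuoidal {
  dcat :> Category;
  circ : Monoidal dcat;
  bul : Monoidal dcat;

  zeta : forall x y a b : dcat,
    hom ((x ⊗[bul] y) ⊗[circ] (a ⊗[bul] b))
        ((x ⊗[circ] a) ⊗[bul] (y ⊗[circ] b));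
  nu : hom (unit circ) (unit circ ⊗[bul] unit circ);
  varpi : hom (unit bul ⊗[circ] unit bul) (unit bul);
  iota : hom (unit circ) (unit bul);

  zeta_nat : forall (x x' y y' a a' b b' : dcat)
      (f : hom x x') (g : hom y y') (h : hom a a') (k : hom b b'),
    zeta x' y' a' b' · ((f ⊠[bul] g) ⊠[circ] (h ⊠[bul] k))
    = ((f ⊠[circ] h) ⊠[bul] (g ⊠[circ] k)) · zeta x y a b;

  one_monoid : is_monoid varpi iota;
  bot_comonoid : is_comonoid nu iota;

  zeta_assoc_circ : forall a b c d e f : dcat,
    zeta a b (c ⊗[circ] e) (d ⊗[circ] f)
      · (idm (a ⊗[bul] b) ⊠[circ] zeta c d e f)
      · assoc circ (a ⊗[bul] b) (c ⊗[bul] d) (e ⊗[bul] f)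
    = (assoc circ a c e ⊠[bul] assoc circ b d f)
      · zeta (a ⊗[circ] c) (b ⊗[circ] d) e f
      · (zeta a b c d ⊠[circ] idm (e ⊗[bul] f));
  zeta_assoc_bul : forall a b c d e f : dcat,
    (idm (a ⊗[circ] d) ⊠[bul] zeta b c e f)
      · zeta a (b ⊗[bul] c) d (e ⊗[bul] f)
      · (assoc bul a b c ⊠[circ] assoc bul d e f)
    = assoc bul (a ⊗[circ] d) (b ⊗[circ] e) (c ⊗[circ] f)
      · (zeta a b d e ⊠[bul] idm (c ⊗[circ] f))
      · zeta (a ⊗[bul] b) c (d ⊗[bul] e) f;

  zeta_nu_l : forall a b : dcat,
    (lunit circ a ⊠[bul] lunit circ b) · zeta (unit circ) (unit circ) a b
      · (nu ⊠[circ] idm (a ⊗[bul] b))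
    = lunit circ (a ⊗[bul] b);
  zeta_nu_r : forall a b : dcat,
    (runit circ a ⊠[bul] runit circ b) · zeta a b (unit circ) (unit circ)
      · (idm (a ⊗[bul] b) ⊠[circ] nu)
    = runit circ (a ⊗[bul] b);
  zeta_varpi_l : forall a b : dcat,
    lunit bul (a ⊗[circ] b) · (varpi ⊠[bul] idm (a ⊗[circ] b))
      · zeta (unit bul) a (unit bul) b
    = lunit bul a ⊠[circ] lunit bul b;
  zeta_varpi_r : forall a b : dcat,
    runit bul (a ⊗[circ] b) · (idm (a ⊗[circ] b) ⊠[bul] varpi)
      · zeta a (unit bul) b (unit bul)
    = runit bul a ⊠[circ] runit bul b
}.

(* The two units are not required to be equal: they are identified through the
   isomorphism [iota]. *)
Record NormalDuoidal : Type := MkNormalDuoidal {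
  nduoidal :> Duoidal;
  iota_iso : IsIso (iota nduoidal)
}.

Record DoubleOpmonoidal (D : Duoidal) (T : Monad D)
    (To : Bimonad (circ D) T) (Tb : Bimonad (bul D) T) : Prop :=
  MkDoubleOpmonoidal {
  dop_nu :
    nu D · opl0 To
    = (opl0 To ⊠[bul D] opl0 To) · opl2 Tb (unit (circ D)) (unit (circ D))
      · fmap T (nu D);
  dop_varpi :
    opl0 Tb · fmap T (varpi D)
    = varpi D · (opl0 Tb ⊠[circ D] opl0 Tb)
      · opl2 To (unit (bul D)) (unit (bul D));
  dop_iota :
    opl0 Tb · fmap T (iota D) = iota D · opl0 To;
  dop_zeta : forall a b c d : D,
    zeta (T a) (T b) (T c) (T d) · (opl2 Tb a b ⊠[circ D] opl2 Tb c d)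
      · opl2 To (a ⊗[bul D] b) (c ⊗[bul D] d)
    = (opl2 To a c ⊠[bul D] opl2 To b d)
      · opl2 Tb (a ⊗[circ D] c) (b ⊗[circ D] d)
      · fmap T (zeta a b c d)
}.

(* [tn] plays the role of ⊗ and [pr] that of ⊙ (par).  In [dist_lr] and the
   like, the first letter is the subscript and the second the superscript of
   ∂: the superscript is the side from which the ⊗-factor [a] acts, the
   subscript the ⊙-factor ([l]eft or [r]ight) that [a] is absorbed into.
   This is the part of a linearly distributive category on which the notion of
   linearly distributive bimonad depends; coherence axioms are not included. *)
Record LinearDistributors (C : Category) (tn pr : Monoidal C) : Type :=
  MkLinearDistributors {
  dist_ll : forall a b c : C,
    hom (a ⊗[tn] (b ⊗[pr] c)) ((a ⊗[tn] b) ⊗[pr] c);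
  dist_rl : forall a b c : C,
    hom (a ⊗[tn] (b ⊗[pr] c)) (b ⊗[pr] (a ⊗[tn] c));
  dist_lr : forall a b c : C,
    hom ((b ⊗[pr] c) ⊗[tn] a) ((b ⊗[tn] a) ⊗[pr] c);
  dist_rr : forall a b c : C,
    hom ((b ⊗[pr] c) ⊗[tn] a) (b ⊗[pr] (c ⊗[tn] a));
  dist_ll_nat : forall (a a' b b' c c' : C)
      (f : hom a a') (g : hom b b') (h : hom c c'),
    dist_ll a' b' c' · (f ⊠[tn] (g ⊠[pr] h))
    = ((f ⊠[tn] g) ⊠[pr] h) · dist_ll a b c;
  dist_rl_nat : forall (a a' b b' c c' : C)
      (f : hom a a') (g : hom b b') (h : hom c c'),
    dist_rl a' b' c' · (f ⊠[tn] (g ⊠[pr] h))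
    = (g ⊠[pr] (f ⊠[tn] h)) · dist_rl a b c;
  dist_lr_nat : forall (a a' b b' c c' : C)
      (f : hom a a') (g : hom b b') (h : hom c c'),
    dist_lr a' b' c' · ((g ⊠[pr] h) ⊠[tn] f)
    = ((g ⊠[tn] f) ⊠[pr] h) · dist_lr a b c;
  dist_rr_nat : forall (a a' b b' c c' : C)
      (f : hom a a') (g : hom b b') (h : hom c c'),
    dist_rr a' b' c' · ((g ⊠[pr] h) ⊠[tn] f)
    = (g ⊠[pr] (h ⊠[tn] f)) · dist_rr a b c
}.

Record LinearlyDistributiveBimonad (C : Category) (tn pr : Monoidal C)
    (d : LinearDistributors tn pr) (T : Monad C)
    (Tt : Bimonad tn T) (Tp : Bimonad pr T) : Prop :=
  MkLinearlyDistributiveBimonad {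
  ldb_ll : forall a b c : Algebra T,
    dist_ll d (T a) (T b) (T c) · (idm (T a) ⊠[tn] opl2 Tp b c)
      · opl2 Tt a (b ⊗[pr] c)
    = (opl2 Tt a b ⊠[pr] idm (T c)) · opl2 Tp (a ⊗[tn] b) c
      · fmap T (dist_ll d a b c);
  ldb_rr : forall a b c : Algebra T,
    dist_rr d (T a) (T b) (T c) · (opl2 Tp b c ⊠[tn] idm (T a))
      · opl2 Tt (b ⊗[pr] c) a
    = (idm (T b) ⊠[pr] opl2 Tt c a) · opl2 Tp b (c ⊗[tn] a)
      · fmap T (dist_rr d a b c);
  ldb_rl : forall a b c : Algebra T,
    dist_rl d (T a) (T b) (T c) · (idm (T a) ⊠[tn] opl2 Tp b c)
      · opl2 Tt a (b ⊗[pr] c)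
    = (idm (T b) ⊠[pr] opl2 Tt a c) · opl2 Tp b (a ⊗[tn] c)
      · fmap T (dist_rl d a b c);
  ldb_lr : forall a b c : Algebra T,
    dist_lr d (T a) (T b) (T c) · (opl2 Tp b c ⊠[tn] idm (T a))
      · opl2 Tt (b ⊗[pr] c) a
    = (opl2 Tt b a ⊠[pr] idm (T c)) · opl2 Tp (b ⊗[tn] a) c
      · fmap T (dist_lr d a b c)
}.

(* The unitors [1 ∘ c ≅ c] and [c ∘ 1 ≅ c], where [1] is the unit of [bul]. *)
Definition lunit1 (D : NormalDuoidal) (c : D) : hom (unit (bul D) ⊗[circ D] c) c :=
  lunit (circ D) c · (inv (iota_iso D) ⊠[circ D] idm c).

Definition runit1 (D : NormalDuoidal) (c : D) : hom (c ⊗[circ D] unit (bul D)) c :=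
  runit (circ D) c · (idm c ⊠[circ D] inv (iota_iso D)).

Definition duo_ll (D : NormalDuoidal) (a b c : D) :
    hom (a ⊗[circ D] (b ⊗[bul D] c)) ((a ⊗[circ D] b) ⊗[bul D] c) :=
  (idm (a ⊗[circ D] b) ⊠[bul D] lunit1 c)
    · zeta a (unit (bul D)) b c
    · (inv (runit_iso (bul D) a) ⊠[circ D] idm (b ⊗[bul D] c)).

Definition duo_rl (D : NormalDuoidal) (a b c : D) :
    hom (a ⊗[circ D] (b ⊗[bul D] c)) (b ⊗[bul D] (a ⊗[circ D] c)) :=
  (lunit1 b ⊠[bul D] idm (a ⊗[circ D] c))
    · zeta (unit (bul D)) a b c
    · (inv (lunit_iso (bul D) a) ⊠[circ D] idm (b ⊗[bul D] c)).

Definition duo_lr (D : NormalDuoidal) (a b c : D) :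
    hom ((b ⊗[bul D] c) ⊗[circ D] a) ((b ⊗[circ D] a) ⊗[bul D] c) :=
  (idm (b ⊗[circ D] a) ⊠[bul D] runit1 c)
    · zeta b c a (unit (bul D))
    · (idm (b ⊗[bul D] c) ⊠[circ D] inv (runit_iso (bul D) a)).

Definition duo_rr (D : NormalDuoidal) (a b c : D) :
    hom ((b ⊗[bul D] c) ⊗[circ D] a) (b ⊗[bul D] (c ⊗[circ D] a)) :=
  (runit1 b ⊠[bul D] idm (c ⊗[circ D] a))
    · zeta b c (unit (bul D)) a
    · (idm (b ⊗[bul D] c) ⊠[circ D] inv (lunit_iso (bul D) a)).

Lemma inv_nat (C : Category) (x y x' y' : C) (p : hom x y) (q : hom x' y')
    (Ip : IsIso p) (Iq : IsIso q) (u : hom x x') (v : hom y y') :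
  q · u = v · p -> inv Iq · v = u · inv Ip.
Proof.
intros H.
rewrite <- (comp_idr (inv Iq · v)), <- (inv_r Ip), comp_assoc.
rewrite <- (comp_assoc (inv Iq) v p), <- H, (comp_assoc (inv Iq) q u).
now rewrite (inv_l Iq), comp_idl.
Qed.

Lemma lunit1_nat (D : NormalDuoidal) (c c' : D) (f : hom c c') :
  lunit1 c' · (idm (unit (bul D)) ⊠[circ D] f) = f · lunit1 c.
Proof.
unfold lunit1; rewrite comp_assoc, <- lunit_nat, <- !comp_assoc.
now rewrite <- !tensm_comp, !comp_idl, !comp_idr.
Qed.

Lemma runit1_nat (D : NormalDuoidal) (c c' : D) (f : hom c c') :
  runit1 c' · (f ⊠[circ D] idm (unit (bul D))) = f · runit1 c.
Proof.
unfold runit1; rewrite comp_assoc, <- runit_nat, <- !comp_assoc.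
now rewrite <- !tensm_comp, !comp_idl, !comp_idr.
Qed.

Section Naturality.
Context (D : NormalDuoidal) (a a' b b' c c' : D).
Context (f : hom a a') (g : hom b b') (h : hom c c').

Lemma duo_ll_nat :
  duo_ll a' b' c' · (f ⊠[circ D] (g ⊠[bul D] h))
  = ((f ⊠[circ D] g) ⊠[bul D] h) · duo_ll a b c.
Proof.
unfold duo_ll; rewrite <- comp_assoc, <- tensm_comp, comp_idl.
rewrite (inv_nat (runit_iso (bul D) a) _ (runit_nat (bul D) f)).
rewrite <- (comp_idr (g ⊠[bul D] h)), tensm_comp, !comp_assoc.
rewrite <- (comp_assoc (idm _ ⊠[bul D] lunit1 c')), zeta_nat, !comp_assoc.
now rewrite <- !tensm_comp, lunit1_nat, comp_idl, comp_idr.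
Qed.

Lemma duo_rl_nat :
  duo_rl a' b' c' · (f ⊠[circ D] (g ⊠[bul D] h))
  = (g ⊠[bul D] (f ⊠[circ D] h)) · duo_rl a b c.
Proof.
unfold duo_rl; rewrite <- comp_assoc, <- tensm_comp, comp_idl.
rewrite (inv_nat (lunit_iso (bul D) a) _ (lunit_nat (bul D) f)).
rewrite <- (comp_idr (g ⊠[bul D] h)), tensm_comp, !comp_assoc.
rewrite <- (comp_assoc (lunit1 b' ⊠[bul D] idm _)), zeta_nat, !comp_assoc.
now rewrite <- !tensm_comp, lunit1_nat, comp_idl, comp_idr.
Qed.

Lemma duo_lr_nat :
  duo_lr a' b' c' · ((g ⊠[bul D] h) ⊠[circ D] f)
  = ((g ⊠[circ D] f) ⊠[bul D] h) · duo_lr a b c.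
Proof.
unfold duo_lr; rewrite <- comp_assoc, <- tensm_comp, comp_idl.
rewrite (inv_nat (runit_iso (bul D) a) _ (runit_nat (bul D) f)).
rewrite <- (comp_idr (g ⊠[bul D] h)), tensm_comp, !comp_assoc.
rewrite <- (comp_assoc (idm _ ⊠[bul D] runit1 c')), zeta_nat, !comp_assoc.
now rewrite <- !tensm_comp, runit1_nat, comp_idl, comp_idr.
Qed.

Lemma duo_rr_nat :
  duo_rr a' b' c' · ((g ⊠[bul D] h) ⊠[circ D] f)
  = (g ⊠[bul D] (h ⊠[circ D] f)) · duo_rr a b c.
Proof.
unfold duo_rr; rewrite <- comp_assoc, <- tensm_comp, comp_idl.
rewrite (inv_nat (lunit_iso (bul D) a) _ (lunit_nat (bul D) f)).
rewrite <- (comp_idr (g ⊠[bul D] h)), tensm_comp, !comp_assoc.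
rewrite <- (comp_assoc (runit1 b' ⊠[bul D] idm _)), zeta_nat, !comp_assoc.
now rewrite <- !tensm_comp, runit1_nat, comp_idl, comp_idr.
Qed.

End Naturality.

Definition duoidal_distributors (D : NormalDuoidal) :
    LinearDistributors (circ D) (bul D) :=
  {| dist_ll := @duo_ll D; dist_rl := @duo_rl D;
     dist_lr := @duo_lr D; dist_rr := @duo_rr D;
     dist_ll_nat := @duo_ll_nat D; dist_rl_nat := @duo_rl_nat D;
     dist_lr_nat := @duo_lr_nat D; dist_rr_nat := @duo_rr_nat D |}.

(* Main.v *)
Require Import Defs.

(** Each of the four distributors of a normal duoidal category is a composite
    [(p • q) · ζ · (i ∘ j)], in which one of [i], [j] inserts a unit of [•]
    by an inverse unitor, the other is an identity, and one of [p], [q]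
    removes a unit of [∘], identified with that of [•] along [ι].  Each of
    the three layers is compatible with the oplax structures of [T]:

    - [ζ] by the interchange axiom of a double opmonoidal monad;
    - the inverse unitors of [•] by the counit axioms of [T^•], inverted
      ([opl_runit_inv], [opl_lunit_inv]); this replaces [T 1] by [1] along
      [T_0^•];
    - the unitors of [∘], read with the unit [1], by the counit axioms of
      [T^∘] ([opl_lunit1], [opl_runit1]): there a factor [T 1] is again
      erased by [T_0^•], because the compatibility of [T] with [ι] says that
      [ι] identifies [T_0^•] with [T_0^∘].

    The copy of [T_0^•] produced by the second item moves through [ζ] by
    naturality and meets the third item.  This pasting of three layers is
    [opl_zeta_composite], of which the four axioms are instances. *)

Set Implicit Arguments.
Unset Strict Implicit.

Local Open Scope cat_scope.

(** * Transport along isomorphisms and unitors *)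

Lemma inv_transpose (C : Category) (x y w : C) (p : hom x y) (Ip : IsIso p)
    (u : hom w x) (v : hom w y) :
  p · u = v -> u = inv Ip · v.
Proof.
intros <-; now rewrite comp_assoc, inv_l, comp_idl.
Qed.

Lemma fmap_inv_r (C D : Category) (F : Functor C D) (x y : C) (p : hom x y)
    (Ip : IsIso p) :
  fmap F p · fmap F (inv Ip) = idm (F y).
Proof.
now rewrite <- fmap_comp, inv_r, fmap_id.
Qed.

Section OplaxUnits.
Context (C : Category) (M : Monoidal C) (F : Functor C C) (O : Oplax M F).

Lemma opl_runit_inv (a : C) :
  inv (runit_iso M (F a))
  = (idm (F a) ⊠[M] opl0 O) · opl2 O a (unit M) · fmap F (inv (runit_iso M a)).
Proof.
symmetry.
rewrite <- (comp_idr (inv (runit_iso M (F a)))).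
apply inv_transpose.
now rewrite !comp_assoc, opl_unit_r, fmap_inv_r.
Qed.

Lemma opl_lunit_inv (a : C) :
  inv (lunit_iso M (F a))
  = (opl0 O ⊠[M] idm (F a)) · opl2 O (unit M) a · fmap F (inv (lunit_iso M a)).
Proof.
symmetry.
rewrite <- (comp_idr (inv (lunit_iso M (F a)))).
apply inv_transpose.
now rewrite !comp_assoc, opl_unit_l, fmap_inv_r.
Qed.

End OplaxUnits.

(** * Compatibility of a double opmonoidal monad with the distributors *)

Section DoubleOpmonoidalMonad.
Context (D : NormalDuoidal) (T : Monad D).
Context (To : Bimonad (circ D) T) (Tb : Bimonad (bul D) T).
Context (dop : DoubleOpmonoidal To Tb).

Lemma opl0_iota_inv :
  opl0 To · fmap T (inv (iota_iso D)) = inv (iota_iso D) · opl0 Tb.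
Proof.
apply inv_transpose.
now rewrite comp_assoc, <- (dop_iota dop), <- comp_assoc, fmap_inv_r, comp_idr.
Qed.

Lemma opl_lunit1 (c : D) :
  lunit1 (T c) · (opl0 Tb ⊠[circ D] idm (T c)) · opl2 To (unit (bul D)) c
  = fmap T (lunit1 c).
Proof.
unfold lunit1.
rewrite fmap_comp, <- (opl_unit_l To c), <- !comp_assoc, opl2_nat, fmap_id.
f_equal; rewrite !comp_assoc; f_equal.
now rewrite <- !tensm_comp, opl0_iota_inv.
Qed.

Lemma opl_runit1 (c : D) :
  runit1 (T c) · (idm (T c) ⊠[circ D] opl0 Tb) · opl2 To c (unit (bul D))
  = fmap T (runit1 c).
Proof.
unfold runit1.
rewrite fmap_comp, <- (opl_unit_r To c), <- !comp_assoc, opl2_nat, fmap_id.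
f_equal; rewrite !comp_assoc; f_equal.
now rewrite <- !tensm_comp, opl0_iota_inv.
Qed.

(** The maps [f], [g], [h], [k] are whatever has to be applied to the four
    factors between [T] of a composite and its counterpart [i'], [j'], [p'],
    [q'] on images of [T]: for the distributors, the counit [T_0^•] on the
    inserted unit and identities elsewhere.  They are created by [i'] and
    [j'], pass through [ζ] by naturality, and are consumed by [p'] and [q'],
    which leaves the residues [P] and [Q]. *)
Lemma opl_zeta_composite (x y z w x' y' z' w' a b m n m' n' : D)
    (f : hom (T x) x') (g : hom (T y) y') (h : hom (T z) z') (k : hom (T w) w')
    (i : hom a (x ⊗[bul D] y)) (i' : hom (T a) (x' ⊗[bul D] y'))
    (j : hom b (z ⊗[bul D] w)) (j' : hom (T b) (z' ⊗[bul D] w'))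
    (p : hom (x ⊗[circ D] z) m) (p' : hom (x' ⊗[circ D] z') m')
    (q : hom (y ⊗[circ D] w) n) (q' : hom (y' ⊗[circ D] w') n')
    (P : hom (T m) m') (Q : hom (T n) n') :
  i' = (f ⊠[bul D] g) · opl2 Tb x y · fmap T i ->
  j' = (h ⊠[bul D] k) · opl2 Tb z w · fmap T j ->
  p' · (f ⊠[circ D] h) · opl2 To x z = P · fmap T p ->
  q' · (g ⊠[circ D] k) · opl2 To y w = Q · fmap T q ->
  (p' ⊠[bul D] q') · zeta x' y' z' w' · (i' ⊠[circ D] j') · opl2 To a b
  = (P ⊠[bul D] Q) · opl2 Tb m n
    · fmap T ((p ⊠[bul D] q) · zeta x y z w · (i ⊠[circ D] j)).
Proof.
intros -> -> Hp Hq.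
rewrite !tensm_comp, !fmap_comp, <- !comp_assoc.
rewrite <- opl2_nat, !comp_assoc; f_equal.
rewrite <- (comp_assoc (p' ⊠[bul D] q') (zeta x' y' z' w')), zeta_nat.
rewrite <- (comp_assoc (P ⊠[bul D] Q)), opl2_nat.
rewrite !comp_assoc, <- !tensm_comp, <- Hp, <- Hq, !tensm_comp.
rewrite <- !comp_assoc; do 2 f_equal.
rewrite !comp_assoc; exact (dop_zeta dop x y z w).
Qed.

(** This and [opl2_id_residue] put the factors that a distributor leaves
    unchanged into the form of the hypotheses of [opl_zeta_composite]. *)
Lemma opl2_id_factor (b c : D) :
  opl2 Tb b c
  = (idm (T b) ⊠[bul D] idm (T c)) · opl2 Tb b c
    · fmap T (idm (b ⊗[bul D] c)).
Proof.
now rewrite tensm_id, fmap_id, comp_idl, comp_idr.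
Qed.

Lemma opl2_id_residue (a b : D) :
  idm (T a ⊗[circ D] T b) · (idm (T a) ⊠[circ D] idm (T b)) · opl2 To a b
  = opl2 To a b · fmap T (idm (a ⊗[circ D] b)).
Proof.
now rewrite tensm_id, fmap_id, !comp_idl, comp_idr.
Qed.

Lemma opl_duo_ll (a b c : D) :
  duo_ll (T a) (T b) (T c) · (idm (T a) ⊠[circ D] opl2 Tb b c)
    · opl2 To a (b ⊗[bul D] c)
  = (opl2 To a b ⊠[bul D] idm (T c)) · opl2 Tb (a ⊗[circ D] b) c
    · fmap T (duo_ll a b c).
Proof.
unfold duo_ll.
rewrite <- (comp_assoc _ (_ ⊠[circ D] _) (_ ⊠[circ D] _)).
rewrite <- tensm_comp, comp_idl, comp_idr.
apply (opl_zeta_composite (opl_runit_inv Tb a) (opl2_id_factor b c)).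
- apply opl2_id_residue.
- rewrite comp_idl; apply opl_lunit1.
Qed.

Lemma opl_duo_rl (a b c : D) :
  duo_rl (T a) (T b) (T c) · (idm (T a) ⊠[circ D] opl2 Tb b c)
    · opl2 To a (b ⊗[bul D] c)
  = (idm (T b) ⊠[bul D] opl2 To a c) · opl2 Tb b (a ⊗[circ D] c)
    · fmap T (duo_rl a b c).
Proof.
unfold duo_rl.
rewrite <- (comp_assoc _ (_ ⊠[circ D] _) (_ ⊠[circ D] _)).
rewrite <- tensm_comp, comp_idl, comp_idr.
apply (opl_zeta_composite (opl_lunit_inv Tb a) (opl2_id_factor b c)).
- rewrite comp_idl; apply opl_lunit1.
- apply opl2_id_residue.
Qed.

Lemma opl_duo_lr (a b c : D) :
  duo_lr (T a) (T b) (T c) · (opl2 Tb b c ⊠[circ D] idm (T a))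
    · opl2 To (b ⊗[bul D] c) a
  = (opl2 To b a ⊠[bul D] idm (T c)) · opl2 Tb (b ⊗[circ D] a) c
    · fmap T (duo_lr a b c).
Proof.
unfold duo_lr.
rewrite <- (comp_assoc _ (_ ⊠[circ D] _) (_ ⊠[circ D] _)).
rewrite <- tensm_comp, comp_idl, comp_idr.
apply (opl_zeta_composite (opl2_id_factor b c) (opl_runit_inv Tb a)).
- apply opl2_id_residue.
- rewrite comp_idl; apply opl_runit1.
Qed.

Lemma opl_duo_rr (a b c : D) :
  duo_rr (T a) (T b) (T c) · (opl2 Tb b c ⊠[circ D] idm (T a))
    · opl2 To (b ⊗[bul D] c) a
  = (idm (T b) ⊠[bul D] opl2 To c a) · opl2 Tb b (c ⊗[circ D] a)
    · fmap T (duo_rr a b c).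
Proof.
unfold duo_rr.
rewrite <- (comp_assoc _ (_ ⊠[circ D] _) (_ ⊠[circ D] _)).
rewrite <- tensm_comp, comp_idl, comp_idr.
apply (opl_zeta_composite (opl2_id_factor b c) (opl_lunit_inv Tb a)).
- rewrite comp_idl; apply opl_runit1.
- apply opl2_id_residue.
Qed.

End DoubleOpmonoidalMonad.

Theorem proposition7p31 (D : NormalDuoidal) (T : Monad D)
    (To : Bimonad (circ D) T) (Tb : Bimonad (bul D) T) :
  DoubleOpmonoidal To Tb ->
  LinearlyDistributiveBimonad (duoidal_distributors D) To Tb.
Proof.
intros dop; constructor; intros a b c; cbn.
- exact (opl_duo_ll dop a b c).
- exact (opl_duo_rr dop a b c).
- exact (opl_duo_rl dop a b c).
- exact (opl_duo_lr dop a b c).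
Qed.
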